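(* Let $L>0$ and let $\rho$ be a metric on $[0,1]$ such that the identity $Id\colon([0,1],\rho)\to([0,1],|\cdot|)$ is $L$-Lipschitz and its inverse $Id^{-1}\colon([0,1],|\cdot|)\to([0,1],\rho)$ is continuous. Then there exist a totally disconnected set $A\subset[0,1]$, with $(A,\rho)$ complete, and an injective Lipschitz map $f\colon(A,\rho)\to([0,1],|\cdot|)$ such that $\widehat f$ is not injective.
   Context: A metric space is totally disconnected if its connected components are the one-point sets. A pointed metric space is a metric space with a distinguished base point $0$. $\mathrm{Lip}_0(M,N)$ is the set of Lipschitz maps $f\colon M\to N$ with $f(0_M)=0_N$; $\mathrm{Lip}_0(M)=\mathrm{Lip}_0(M,\mathbb R)$ is a Banach space for the norm $\|f\|_L$ = best Lipschitz constant of $f$. For $x\in M$, $\delta(x)\in \mathrm{Lip}_0(M)^*$ is the evaluation $\langle f,\delta(x)\rangle=f(x)$. The Lipschitz-free space $\mathcal F(M)$ is the norm-closed linear span of $\{\delta(x):x\in M\}$ in $\mathrm{Lip}_0(M)^*$. For $f\in \mathrm{Lip}_0(M,N)$, $\widehat f\colon \mathcal F(M)\to\mathcal F(N)$ is the unique bounded linear operator with $\widehat f(\delta(x))=\delta(f(x))$ for all $x\in M$. In the claim, base points of $A$ and $[0,1]$ are chosen so that $f$ maps base point to base point (e.g. $0\in A$ and $f(0)=0$); the choice of base points is irrelevant up to isometric isomorphism. *)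

(* Defs.v *)
From HB Require Import structures.
From mathcomp Require Import all_boot all_order all_algebra.
From mathcomp Require Import all_classical all_reals all_analysis.
Set Implicit Arguments.
Unset Strict Implicit.
Unset Printing Implicit Defensive.
Import Order.TTheory GRing.Theory Num.Theory.
Import numFieldNormedType.Exports.
Local Open Scope classical_set_scope.
Local Open Scope ring_scope.

(* A subset of a metric space, seen as a metric space for the restricted
   distance; the library already gives [set_type A] the compatible
   pseudometric structure. *)
Section set_type_metric.
Context {R : realType} {X : metricType R} (A : set X).

Let dist (x y : A) : R := mdist (set_val x) (set_val y).

Let dist_ge0 x y : 0 <= dist x y. Proof. exact: mdist_ge0. Qed.

Let dist_positivity x y : dist x y = 0 -> x = y.
Proof. by move=> /mdist_positivity; exact: val_inj. Qed.

Let ball_distE (x : A) (d : R) : ball x d = [set y | dist x y < d].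
Proof.
apply/seteqP; split => y; rewrite /dist/=.
  by move=> h; have : ball (set_val x) d (set_val y) by []; rewrite ballEmdist.
by move=> h; have : ball (set_val x) d (set_val y) by rewrite ballEmdist.
Qed.

HB.instance Definition _ :=
  @PseudoMetric_isMetric.Build R (set_type A) dist dist_ge0 dist_positivity
    ball_distE.

End set_type_metric.

Record metric (R : realType) (T : Type) := Metric {
  metric_dist :> T -> T -> R ;
  metric_distxx : forall x, metric_dist x x = 0 ;
  metric_dist_eq0 : forall x y, metric_dist x y = 0 -> x = y ;
  metric_dist_sym : forall x y, metric_dist x y = metric_dist y x ;
  metric_dist_triangle : forall y x z,
    metric_dist x z <= metric_dist x y + metric_dist y z }.

Definition metric_space (R : realType) (T : choiceType) (rho : metric R T) : Type
  := T.

HB.instance Definition _ (R : realType) (T : choiceType) (rho : metric R T) :=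
  Choice.on (metric_space rho).
HB.instance Definition _ (R : realType) (T : choiceType) (rho : metric R T) :=
  @isMetric.Build R (metric_space rho) rho (metric_distxx rho)
    (@metric_dist_eq0 _ _ rho) (metric_dist_sym rho) (metric_dist_triangle rho).

(* [R^o] is the type carrying the usual distance of the reals. *)
Definition unit_interval (R : realType) : set R^o := [set x | 0 <= x <= 1].
Arguments unit_interval : clear implicits.

Definition complete_space (T : uniformType) :=
  forall F : set_system T, ProperFilter F -> cauchy F -> exists x : T, F --> x.

Definition lipschitz_map (R : realType) (M N : metricType R) (k : R)
    (f : M -> N) :=
  forall x y, mdist (f x) (f y) <= k * mdist x y.

Definition bounded_linear (R : realType) (V W : normedModType R) (T : V -> W) :=
  linear T /\ exists k : R, forall x, `|T x| <= k * `|x|.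

Definition linear_span (R : realType) (V : lmodType R) (S : set V) : set V :=
  [set v | exists n (a : 'I_n -> R) (s : 'I_n -> V),
     (forall i, S (s i)) /\ v = \sum_(i < n) a i *: s i].

(* The least [k >= 0] such that [|p i| <= k * w i] for all [i]: it gives both
   the best Lipschitz constant of a function and the norm of a functional. *)
Definition best_constant (R : realType) (I : Type) (p w : I -> R) : R :=
  inf [set k | 0 <= k /\ forall i, `|p i| <= k * w i].

Section best_constant_theory.
Context {R : realType} {I : Type}.
Implicit Types (p q w : I -> R) (k : R).

Let adm p w := [set k | 0 <= k /\ forall i, `|p i| <= k * w i].

Let adm_lb p w : has_lbound (adm p w).
Proof. by exists 0 => k []. Qed.

Lemma best_constant_le p w k :
  0 <= k -> (forall i, `|p i| <= k * w i) -> best_constant p w <= k.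
Proof. by move=> k0 pk; apply: ge_inf; [exact: adm_lb|split]. Qed.

Lemma best_constant_ge0 p w : 0 <= best_constant p w.
Proof.
rewrite /best_constant -/(adm p w).
have [->|/set0P adm0] := eqVneq (adm p w) set0; first by rewrite inf0.
by apply: lb_le_inf => // k [].
Qed.

Lemma best_constantP p w : (forall i, 0 <= w i) ->
  (exists k, forall i, `|p i| <= k * w i) ->
  forall i, `|p i| <= best_constant p w * w i.
Proof.
move=> w0 [k0 pk0] i.
have adm0 : adm p w !=set0.
  exists `|k0|; split => // j; apply: (le_trans (pk0 j)).
  by apply: ler_wpM2r => //; exact: ler_norm.
have [wi0|wi0] := eqVneq (w i) 0.
  by have := pk0 i; rewrite wi0 !mulr0.
have wi : 0 < w i by rewrite lt_neqAle eq_sym wi0 w0.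
rewrite -ler_pdivrMr//; apply: lb_le_inf => // k [_ pk].
by rewrite ler_pdivrMr.
Qed.

Lemma best_constantD p q w : (forall i, 0 <= w i) ->
  (exists k, forall i, `|p i| <= k * w i) ->
  (exists k, forall i, `|q i| <= k * w i) ->
  best_constant (fun i => p i + q i) w <= best_constant p w + best_constant q w.
Proof.
move=> w0 pk qk; apply: best_constant_le => [|i].
  by rewrite addr_ge0 ?best_constant_ge0.
rewrite (le_trans (ler_normD _ _))// mulrDl.
by apply: lerD; exact: best_constantP.
Qed.

Let best_constantZ_le p w (a : R) : (forall i, 0 <= w i) ->
  (exists k, forall i, `|p i| <= k * w i) ->
  best_constant (fun i => a * p i) w <= `|a| * best_constant p w.
Proof.
move=> w0 pk; apply: best_constant_le => [|i].
  by rewrite mulr_ge0 ?best_constant_ge0.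
by rewrite normrM -mulrA ler_wpM2l// best_constantP.
Qed.

Lemma best_constantZ p w (a : R) : (forall i, 0 <= w i) ->
  (exists k, forall i, `|p i| <= k * w i) ->
  best_constant (fun i => a * p i) w = `|a| * best_constant p w.
Proof.
move=> w0 pk; apply/eqP; rewrite eq_le best_constantZ_le//=.
have [->|a0] := eqVneq a 0; first by rewrite normr0 mul0r best_constant_ge0.
have {1}-> : p = (fun i => a^-1 * (a * p i)).
  by apply/funext => i; rewrite mulKf.
rewrite -ler_pdivlMl ?normr_gt0// -normfV; apply: best_constantZ_le => //.
case: pk => k pk; exists (`|a| * k) => i.
by rewrite normrM -mulrA ler_wpM2l//.
Qed.

Lemma best_constant_eq0 p w : (forall i, 0 <= w i) ->
  (exists k, forall i, `|p i| <= k * w i) ->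
  best_constant p w = 0 -> forall i, p i = 0.
Proof.
move=> w0 pk pw0 i; apply/eqP; rewrite -normr_le0.
by have := best_constantP w0 pk i; rewrite pw0 mul0r.
Qed.

End best_constant_theory.

Section Lip0.
Context {R : realType} {M : metricType R}.

Definition lip0_pred (m0 : M) : {pred M -> R^o} :=
  fun f => `[< f m0 = 0 /\ exists k, lipschitz_map k f >].

Lemma lip0_predP m0 (f : M -> R^o) :
  reflect (f m0 = 0 /\ exists k, lipschitz_map k f) (f \in lip0_pred m0).
Proof. exact: asboolP. Qed.

Record Lip0 (m0 : M) := MkLip0 {
  lip0_fun :> M -> R^o ;
  lip0_mem : lip0_fun \in lip0_pred m0 }.

Variable m0 : M.

HB.instance Definition _ := [isSub for @lip0_fun m0].
HB.instance Definition _ := [Choice of Lip0 m0 by <:].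

Lemma lip0_lip (f : Lip0 m0) :
  exists k, forall x : M * M, `|f x.2 - f x.1| <= k * mdist x.1 x.2.
Proof. by case: f => f /= /lip0_predP[_ [k fk]]; exists k => x; exact: fk. Qed.

Lemma lip0_base (f : Lip0 m0) : f m0 = 0.
Proof. by case: f => f /= /lip0_predP[]. Qed.

Lemma lip0_submod : submod_closed (lip0_pred m0).
Proof.
split.
  apply/lip0_predP; split => //; exists 0 => x y.
  by rewrite mul0r /mdist/= subrr normr0.
move=> a f g /lip0_predP[f0 [k fk]] /lip0_predP[g0 [l gl]].
apply/lip0_predP; split.
  by rewrite /GRing.add/GRing.scale/= f0 g0 scaler0 addr0.
exists (`|a| * k + l) => x y; rewrite /mdist/=.
have -> : (a *: f + g) y - (a *: f + g) x = a * (f y - f x) + (g y - g x).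
  by rewrite !fctE mulrBr opprD addrACA.
rewrite (le_trans (ler_normD _ _))// mulrDl; apply: lerD; last exact: gl.
by rewrite normrM -mulrA ler_wpM2l//; exact: fk.
Qed.

HB.instance Definition _ :=
  GRing.isSubmodClosed.Build R (M -> R^o) (lip0_pred m0) lip0_submod.
HB.instance Definition _ := [SubChoice_isSubLmodule of Lip0 m0 by <:].

Lemma lip0D (f g : Lip0 m0) x : (f + g) x = f x + g x.
Proof. by []. Qed.

Lemma lip0Z a (f : Lip0 m0) x : (a *: f) x = a * f x.
Proof. by []. Qed.

Definition lip_norm (f : Lip0 m0) : R :=
  best_constant (fun x : M * M => f x.2 - f x.1) (fun x => mdist x.1 x.2).

Let w0 (x : M * M) : 0 <= mdist x.1 x.2. Proof. exact: mdist_ge0. Qed.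

Let normD (f g : Lip0 m0) : lip_norm (f + g) <= lip_norm f + lip_norm g.
Proof.
rewrite /lip_norm.
rewrite (_ : (fun x : M * M => _) =
  fun x => (f x.2 - f x.1) + (g x.2 - g x.1)); last first.
  by apply/funext => x; rewrite !lip0D opprD addrACA.
by apply: best_constantD => //; exact: lip0_lip.
Qed.

Let normZ a (f : Lip0 m0) : lip_norm (a *: f) = `|a| * lip_norm f.
Proof.
rewrite /lip_norm (_ : (fun x : M * M => _) = fun x => a * (f x.2 - f x.1)).
  by apply: best_constantZ => //; exact: lip0_lip.
by apply/funext => x; rewrite !lip0Z mulrBr.
Qed.

Let norm_eq0 (f : Lip0 m0) : lip_norm f = 0 -> f = 0.
Proof.
move=> /(best_constant_eq0 w0 (lip0_lip f)) f0.
apply/val_inj/funext => x /=; have /= := f0 (m0, x).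
by rewrite lip0_base subr0.
Qed.

HB.instance Definition _ :=
  @Lmodule_isNormed.Build R (Lip0 m0) lip_norm normD normZ norm_eq0.

Lemma lip0_normE (f : Lip0 m0) : `|f| = lip_norm f. Proof. by []. Qed.

Lemma lip0_normP (f : Lip0 m0) x y : `|f y - f x| <= `|f| * mdist x y.
Proof. exact: (best_constantP w0 (lip0_lip f) (x, y)). Qed.

End Lip0.

Section dual.
Context {R : realType} (V : normedModType R).

Definition dual_pred : {pred V -> R^o} := fun phi => `[< bounded_linear phi >].

Lemma dual_predP (phi : V -> R^o) : reflect (bounded_linear phi) (phi \in dual_pred).
Proof. exact: asboolP. Qed.

Record dual := MkDual {
  dual_fun :> V -> R^o ;
  dual_mem : dual_fun \in dual_pred }.

HB.instance Definition _ := [isSub for dual_fun].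
HB.instance Definition _ := [Choice of dual by <:].

Lemma dual_bounded (phi : dual) : exists k, forall v, `|phi v| <= k * `|v|.
Proof. by case: phi => phi /= /dual_predP[]. Qed.

Lemma dual_linear (phi : dual) : linear phi.
Proof. by case: phi => phi /= /dual_predP[]. Qed.

Lemma dual_submod : submod_closed dual_pred.
Proof.
split.
  apply/dual_predP; split => [a u v|]; first by rewrite -[RHS]/(a *: (0 : R^o) + 0) scaler0 addr0.
  by exists 0 => v; rewrite normr0 mul0r.
move=> a f g /dual_predP[lf [k fk]] /dual_predP[lg [l gl]].
apply/dual_predP; split.
  move=> b u v; rewrite !fctE lf lg.
  by rewrite [in LHS]scalerDr [in RHS]scalerDr !scalerA [b * a]mulrC addrACA.
exists (`|a| * k + l) => v; rewrite !fctE.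
rewrite (le_trans (ler_normD _ _))// mulrDl; apply: lerD; last exact: gl.
by rewrite normrZ -mulrA ler_wpM2l//.
Qed.

HB.instance Definition _ :=
  GRing.isSubmodClosed.Build R (V -> R^o) dual_pred dual_submod.
HB.instance Definition _ := [SubChoice_isSubLmodule of dual by <:].

Lemma dualD (f g : dual) x : (f + g) x = f x + g x.
Proof. by []. Qed.

Lemma dualZ a (f : dual) x : (a *: f) x = a * f x.
Proof. by []. Qed.

Definition dual_norm (phi : dual) : R :=
  best_constant (fun v => phi v : R) (fun v => `|v|).

Let w0 (v : V) : 0 <= `|v|. Proof. exact: normr_ge0. Qed.

Let normD (f g : dual) : dual_norm (f + g) <= dual_norm f + dual_norm g.
Proof. by apply: best_constantD => //; exact: dual_bounded. Qed.

Let normZ a (f : dual) : dual_norm (a *: f) = `|a| * dual_norm f.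
Proof. by apply: best_constantZ => //; exact: dual_bounded. Qed.

Let norm_eq0 (f : dual) : dual_norm f = 0 -> f = 0.
Proof.
move=> /(best_constant_eq0 w0 (dual_bounded f)) f0.
by apply/val_inj/funext => x /=; exact: f0.
Qed.

HB.instance Definition _ :=
  @Lmodule_isNormed.Build R dual dual_norm normD normZ norm_eq0.

Lemma dual_normE (f : dual) : `|f| = dual_norm f. Proof. by []. Qed.

Lemma dual_normP (f : dual) v : `|f v| <= `|f| * `|v|.
Proof. exact: (best_constantP w0 (dual_bounded f)). Qed.

End dual.

Section linear_span_theory.
Context {R : realType}.

Lemma linear_span_sub (V : lmodType R) (S : set V) : S `<=` linear_span S.
Proof.
move=> v Sv; exists 1%N, (fun=> 1), (fun=> v); split => //.
by rewrite big_ord1 scale1r.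
Qed.

Lemma linear_span0 (V : lmodType R) (S : set V) : linear_span S 0.
Proof.
exists 0%N, (fun=> 0), (fun=> 0); split; first by case.
by rewrite big_ord0.
Qed.

Lemma linear_spanP (V : lmodType R) (S : set V) a u v :
  linear_span S u -> linear_span S v -> linear_span S (a *: u + v).
Proof.
move=> [n [b [s [Ss ->]]]] [m [c [t [St ->]]]]; exists (n + m)%N.
exists (fun i => match fintype.split i with inl j => a * b j | inr j => c j end).
exists (fun i => match fintype.split i with inl j => s j | inr j => t j end).
split; first by move=> i; case: (fintype.split i).
rewrite big_split_ord/= scaler_sumr; congr (_ + _); apply: eq_bigr => i _.
  by rewrite (unsplitK (inl _ i)) scalerA.
by rewrite (unsplitK (inr _ i)).
Qed.

Lemma closure_normP (V : normedModType R) (A : set V) v :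
  closure A v <-> forall e : R, 0 < e -> exists2 u, A u & `|v - u| < e.
Proof.
split=> [cAv e e0|cAv B].
  have [u [Au]] := cAv _ (nbhsx_ballx v e e0).
  by rewrite -ball_normE /= => vu; exists u.
rewrite -nbhs_ballE => -[e /= e0 vB]; have [u Au vu] := cAv e e0.
by exists u; split => //; apply: vB; rewrite -ball_normE.
Qed.

Lemma closure_span_submod (V : normedModType R) (S : set V) :
  submod_closed (mem (closure (linear_span S))).
Proof.
split; first by rewrite inE; apply: subset_closure; exact: linear_span0.
move=> a u v; rewrite !inE => /closure_normP cu /closure_normP cv.
apply/closure_normP => e e0.
have d0 : 0 < e / 2 / (`|a| + 1) by rewrite !divr_gt0// ltr_wpDl.
have e2 : 0 < e / 2 by rewrite divr_gt0.
have [u' Su' uu'] := cu _ d0; have [v' Sv' vv'] := cv _ e2.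
exists (a *: u' + v'); first exact: linear_spanP.
rewrite opprD addrACA -scalerBr (le_lt_trans (ler_normD _ _))//.
rewrite [ltRHS]splitr ler_ltD// normrZ.
rewrite (@le_trans _ _ (`|a| * (e / 2 / (`|a| + 1))))//.
  by rewrite ler_wpM2l// ltW.
rewrite mulrA ler_pdivrMr ?ltr_wpDl// mulrC ler_wpM2l//; first exact: ltW.
by rewrite lerDl.
Qed.

End linear_span_theory.

Section free_space.
Context {R : realType} {M : metricType R}.

Section evaluation.
Variables (m0 x : M).

Let evalP : (fun f : Lip0 m0 => f x) \in @dual_pred R (Lip0 m0).
Proof.
apply/dual_predP; split => //; exists (mdist m0 x) => f.
by have := lip0_normP f m0 x; rewrite lip0_base subr0 mulrC.
Qed.

Definition eval : dual (Lip0 m0) := MkDual evalP.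

End evaluation.

Definition free_pred (m0 : M) : {pred dual (Lip0 m0)} :=
  mem (closure (linear_span (range (eval m0)))).
Arguments free_pred : clear implicits.

Lemma free_predP m0 phi :
  reflect (closure (linear_span (range (eval m0))) phi) (phi \in free_pred m0).
Proof. exact: asboolP. Qed.

Record free_space (m0 : M) := MkFree {
  free_val :> dual (Lip0 m0) ;
  free_mem : free_val \in free_pred m0 }.

Variable m0 : M.

HB.instance Definition _ := [isSub for @free_val m0].
HB.instance Definition _ := [Choice of free_space m0 by <:].
HB.instance Definition _ :=
  GRing.isSubmodClosed.Build R (dual (Lip0 m0)) (free_pred m0)
    (closure_span_submod (range (eval m0))).
HB.instance Definition _ := [SubChoice_isSubLmodule of free_space m0 by <:].

Definition free_norm (u : free_space m0) : R := `|free_val u|.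

Let normD (u v : free_space m0) : free_norm (u + v) <= free_norm u + free_norm v.
Proof. exact: ler_normD. Qed.

Let normZ a (u : free_space m0) : free_norm (a *: u) = `|a| * free_norm u.
Proof. exact: normrZ. Qed.

Let norm_eq0 (u : free_space m0) : free_norm u = 0 -> u = 0.
Proof. by move=> /normr0_eq0 u0; apply: val_inj. Qed.

HB.instance Definition _ :=
  @Lmodule_isNormed.Build R (free_space m0) free_norm normD normZ norm_eq0.

Lemma free_normE (u : free_space m0) : `|u| = `|free_val u|. Proof. by []. Qed.

Let deltaP x : eval m0 x \in free_pred m0.
Proof. by apply/free_predP/subset_closure/linear_span_sub; exists x. Qed.

Definition delta (x : M) : free_space m0 := MkFree (deltaP x).

End free_space.
Arguments free_pred {R M} m0 _.

Record lip0_map (R : realType) (M N : metricType R) (m0 : M) (n0 : N) :=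
  MkLip0Map {
    lip0_map_fun :> M -> N ;
    lip0_map_base : lip0_map_fun m0 = n0 ;
    lip0_map_lip : exists k, lipschitz_map k lip0_map_fun }.

Definition linearizes (R : realType) (M N : metricType R) (m0 : M) (n0 : N)
    (f : lip0_map m0 n0) (T : free_space m0 -> free_space n0) :=
  bounded_linear T /\ forall x, T (delta m0 x) = delta n0 (f x).

Section linearization.
Context {R : realType} {M N : metricType R} {m0 : M} {n0 : N}.
Variable f : lip0_map m0 n0.

Let lipf : exists2 k, 0 <= k & lipschitz_map k f.
Proof.
have [k fk] := lip0_map_lip f; exists `|k| => // x y.
by rewrite (le_trans (fk _ _))// ler_wpM2r ?mdist_ge0 ?ler_norm.
Qed.

Let compP (g : Lip0 n0) : (fun x => g (f x)) \in lip0_pred m0.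
Proof.
apply/lip0_predP; split; first by rewrite lip0_map_base lip0_base.
have [k k0 fk] := lipf; exists (`|g| * k) => x y.
by rewrite (le_trans (lip0_normP g _ _))// -mulrA ler_wpM2l//.
Qed.

Let comp (g : Lip0 n0) : Lip0 m0 := MkLip0 (compP g).

Let comp_norm k : 0 <= k -> lipschitz_map k f ->
  forall g, `|comp g| <= k * `|g|.
Proof.
move=> k0 fk g; apply: best_constant_le => [|x]; first exact: mulr_ge0.
rewrite (le_trans (lip0_normP g _ _))// [k * _]mulrC -mulrA ler_wpM2l//.
Qed.

Let transP (phi : dual (Lip0 m0)) :
  (fun g => phi (comp g)) \in @dual_pred R (Lip0 n0).
Proof.
apply/dual_predP; split.
  move=> a g h; rewrite -dual_linear; congr (phi _).
  exact: val_inj.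
have [k k0 fk] := lipf; exists (`|phi| * k) => g.
rewrite (le_trans (dual_normP phi _))// -mulrA ler_wpM2l//.
exact: comp_norm.
Qed.

Let trans (phi : dual (Lip0 m0)) : dual (Lip0 n0) := MkDual (transP phi).

Let trans_norm k : 0 <= k -> lipschitz_map k f ->
  forall phi, `|trans phi| <= k * `|phi|.
Proof.
move=> k0 fk phi; apply: best_constant_le => [|g]; first exact: mulr_ge0.
rewrite (le_trans (dual_normP phi _))// [k * _]mulrC -mulrA ler_wpM2l//.
exact: comp_norm.
Qed.

Let transD a phi psi : trans (a *: phi + psi) = a *: trans phi + trans psi.
Proof. exact: val_inj. Qed.

Let trans_span phi : linear_span (range (eval m0)) phi ->
  linear_span (range (eval n0)) (trans phi).
Proof.
move=> [n [a [s [Ss ->]]]].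
have : forall i, exists x, eval m0 x = s i.
  by move=> i; have [x _ <-] := Ss i; exists x.
move=> /choice[x xs]; exists n, a, (fun i => eval n0 (f (x i))); split.
  by move=> i; exists (f (x i)).
under eq_bigr do rewrite -xs; elim: n a {s Ss xs} x => [|n IH] a x.
  by rewrite !big_ord0; exact: val_inj.
rewrite !big_ord_recl transD IH; congr (_ *: _ + _).
exact: val_inj.
Qed.

Let trans_free (u : free_space m0) : trans u \in free_pred n0.
Proof.
case: u => u /= /free_predP /closure_normP cu; apply/free_predP/closure_normP => e e0.
have [k k0 fk] := lipf.
have k1 : 0 < k + 1 by rewrite ltr_wpDl.
have [v Sv uv] := cu _ (divr_gt0 e0 k1).
exists (trans v); first exact: trans_span.
have -> : trans u - trans v = trans (u - v) by exact: val_inj.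
rewrite (le_lt_trans (trans_norm k0 fk _))//.
rewrite (@le_lt_trans _ _ ((k + 1) * `|u - v|))//.
  by rewrite ler_wpM2r// lerDl.
by rewrite mulrC -ltr_pdivlMr.
Qed.

Lemma linearizes_exists_unique : exists! T, linearizes f T.
Proof.
exists (fun u => MkFree (trans_free u)); split.
  split; last by move=> x; do 2 apply: val_inj.
  split; first by move=> a u v; apply: val_inj; exact: transD.
  have [k k0 fk] := lipf; exists k => u.
  by rewrite !free_normE; exact: trans_norm.
move=> T [[Tlin [k Tk]] Tdelta]; apply/funext => u; apply: val_inj => /=.
have TD (v w : free_space m0) a : free_val (T (a *: v + w)) =
   a *: free_val (T v) + free_val (T w) by rewrite Tlin.
have Tspan v : linear_span (range (eval m0)) (free_val v) ->
    free_val (T v) = trans v.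
  case: v => v0 /= vP [n [a [s [Ss vE]]]].
  have [x xs] : exists x : 'I_n -> M, forall i, eval m0 (x i) = s i.
    suff : forall i, exists x, eval m0 x = s i.
      by move=> /choice[x xs]; exists x.
    by move=> i; have [x _ <-] := Ss i; exists x.
  have -> : MkFree vP = \sum_(i < n) a i *: delta m0 (x i).
    apply: val_inj; rewrite [RHS]raddf_sum/= vE; apply: eq_bigr => i _.
    by rewrite -xs.
  have -> : v0 = \sum_(i < n) a i *: eval m0 (x i).
    by rewrite vE; apply: eq_bigr => i _; rewrite xs.
  elim: n a x {s Ss vE xs} => [|n IH] a x.
    rewrite !big_ord0; have /= := TD 0 0 (- 1).
    by rewrite scaleN1r oppr0 addr0 scaleN1r addNr => ->; exact: val_inj.
  rewrite !big_ord_recl TD IH transD Tdelta; congr (_ *: _ + _).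
  exact: val_inj.
apply/eqP; rewrite -subr_eq0 -normr_le0; apply/ler_addgt0Pl => e e0.
rewrite addr0.
have [l l0 fl] := lipf.
have kl1 : 0 < l + `|k| + 1 by rewrite ltr_wpDl// addr_ge0.
have := free_mem u => /free_predP/closure_normP/(_ _ (divr_gt0 e0 kl1)).
move=> [v Sv uv].
have vF : v \in free_pred m0 by apply/free_predP; exact: subset_closure.
have Tv := Tspan (MkFree vF) Sv.
have -> : trans u - free_val (T u) =
    trans (free_val u - v) - free_val (T (u - MkFree vF)).
  have -> : trans (free_val u - v) = trans u - trans v by exact: val_inj.
  have -> : u - MkFree vF = -1 *: MkFree vF + u by rewrite scaleN1r addrC.
  by rewrite TD Tv /= scaleN1r opprD opprK addrA subrK.
rewrite (le_trans (ler_normB _ _))//.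
have Tuv : `|free_val (T (u - MkFree vF))| <= `|k| * `|free_val u - v|.
  rewrite -free_normE (le_trans (Tk _))// free_normE ler_wpM2r//.
  exact: ler_norm.
rewrite (le_trans (lerD (trans_norm l0 fl _) Tuv))// -mulrDl.
rewrite (@le_trans _ _ ((l + `|k| + 1) * `|free_val u - v|))//.
  by rewrite ler_wpM2r// lerDl.
by rewrite mulrC -ler_pdivlMr// ltW.
Qed.

Definition linearization : free_space m0 -> free_space n0 :=
  sval (cid linearizes_exists_unique).

Lemma linearizationP : linearizes f linearization.
Proof. by have [] := svalP (cid linearizes_exists_unique). Qed.

Lemma linearization_unique T : linearizes f T -> linearization = T.
Proof. by have [_] := svalP (cid linearizes_exists_unique); apply. Qed.

End linearization.

(* Main.v *)
Require Import Defs.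
From HB Require Import structures.
From mathcomp Require Import all_boot all_order all_algebra.
From mathcomp Require Import all_classical all_reals all_analysis.
From mathcomp Require Import ring lra.
Set Implicit Arguments.
Unset Strict Implicit.
Unset Printing Implicit Defensive.
Import Order.TTheory GRing.Theory Num.Theory.
Import numFieldNormedType.Exports.
Local Open Scope classical_set_scope.
Local Open Scope ring_scope.

(* Remove from [0,1] a sequence of pairwise disjoint open gaps ]p n, q n[ whose
   union is dense, so short that the sum of rho (p n, q n) converges and
   the sum of q n - p n is at most 1/2; let A be the complement.  The function
   f(x) = total length of the gaps to the left of x is injective on A, as two
   points of A are separated by a gap, and 1-Lipschitz for |.|.  The series
     gamma = delta 1 - delta 0 - sum_n (delta (q n) - delta (p n))
   converges absolutely in F(A, rho).  The coordinate function, which is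
   L-Lipschitz for rho, shows gamma <> 0.  But f maps the gaps onto disjoint
   intervals of full total length in [0, f 1], so that g o f has the same total
   increment as the sum of its increments over the gaps for every Lipschitz g:
   the linearization of f kills gamma. *)

(** * Truncation to an interval *)

Definition clamp (R : realType) (p q x : R) : R := Num.max p (Num.min x q).

Section clamp.
Context {R : realType}.
Implicit Types p q x y : R.

Lemma clamp_le p q x : p <= q -> x <= p -> clamp p q x = p.
Proof.
by move=> pq xp; rewrite /clamp (min_idPl _) ?(max_idPl _)// (le_trans xp).
Qed.

Lemma clamp_ge p q x : p <= q -> q <= x -> clamp p q x = q.
Proof. by move=> pq qx; rewrite /clamp (min_idPr _)// (max_idPr _). Qed.

Lemma clamp_id p q x : p <= x <= q -> clamp p q x = x.
Proof. by move=> /andP[px xq]; rewrite /clamp (min_idPl _)// (max_idPr _). Qed.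

Lemma clamp_itv p q x : p <= q -> p <= clamp p q x <= q.
Proof.
by move=> pq; rewrite /clamp le_max lexx/= ge_max pq/= ge_min lexx orbT.
Qed.

Lemma clamp_homo p q : {homo clamp p q : x y / x <= y}.
Proof. by move=> x y xy; apply: le_max2 => //; apply: le_min2. Qed.

(** Both sides are the length of the intersection of [p, q] and [x, y]. The exchange turns a sum
    over gaps of increments of different functions into increments of the single function
    [clamp x y], to which [sum_increments_le] applies. *)
Lemma clampB_sym p q x y : p <= q -> x <= y ->
  clamp p q y - clamp p q x = clamp x y q - clamp x y p.
Proof.
move=> pq xy; have [qx|xq] := leP q x.
  have px := le_trans pq qx; have qy := le_trans qx xy.
  by rewrite [clamp p q y]clamp_ge// [clamp p q x]clamp_ge//
    [clamp x y q]clamp_le// clamp_le// !subrr.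
have [yp|py] := leP y p.
  have yq := le_trans yp pq; have xp := le_trans xy yp.
  by rewrite [clamp p q y]clamp_le// [clamp p q x]clamp_le//
    [clamp x y q]clamp_ge// clamp_ge// !subrr.
have -> : clamp p q y = Num.min y q by apply/max_idPr; rewrite le_min ltW.
have -> : clamp x y q = Num.min q y by apply/max_idPr; rewrite le_min ltW.
rewrite minC; congr (_ - _); rewrite /clamp (min_idPl _) ?ltW// maxC.
by rewrite (min_idPl _) ?ltW.
Qed.

End clamp.

(** * Increments over disjoint gaps, and the gap length function *)

Section gaps.
Context {R : realType} (a b : R) (p q : nat -> R).
Hypothesis gap_itv : forall n, a <= p n /\ p n <= q n /\ q n <= b.
Hypothesis gap_disj : forall i j, i != j -> q i <= p j \/ q j <= p i.

(** The gaps come in no particular order. Instead of sorting them, the induction discards the last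
    one and changes [H], which is why [H] stays general. *)
Lemma sum_increments_le (H : R -> R) N : {homo H : x y / x <= y} ->
  \sum_(n < N) (H (q n) - H (p n)) <= H b - H a.
Proof.
elim: N H => [|N IH] H Hhomo.
  by rewrite big_ord0 subr_ge0 Hhomo//; have := gap_itv 0; lra.
have [aN [pqN bN]] := gap_itv N.
(* Collapsing the last gap gives a nondecreasing function with the same
   increments over the other gaps. *)
pose K t := H t - H (clamp (p N) (q N) t).
have Khomo : {homo K : x y / x <= y}.
  move=> x y xy; rewrite /K.
  have [yp|py] := leP y (p N).
    by rewrite !clamp_le// ?(le_trans xy)//; have := Hhomo _ _ xy; lra.
  have [qx|xq] := leP (q N) x.
    by rewrite !clamp_ge// ?(le_trans _ xy)//; have := Hhomo _ _ xy; lra.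
  have : H x - H (clamp (p N) (q N) x) <= 0.
    have [xp|px] := leP x (p N).
      by rewrite clamp_le//; have := Hhomo _ _ xp; lra.
    by rewrite clamp_id ?subrr// !ltW.
  have : 0 <= H y - H (clamp (p N) (q N) y).
    have [qy|yq] := leP (q N) y.
      by rewrite clamp_ge//; have := Hhomo _ _ qy; lra.
    by rewrite clamp_id ?subrr// !ltW.
  lra.
have Ka : K a = H a - H (p N) by rewrite /K clamp_le.
have Kb : K b = H b - H (q N) by rewrite /K clamp_ge.
have := IH K Khomo; rewrite big_ord_recr/= Ka Kb.
have -> : \sum_(n < N) (K (q n) - K (p n)) = \sum_(n < N) (H (q n) - H (p n)).
  apply: eq_bigr => n _; rewrite /K; have [_ [pqn _]] := gap_itv n.
  have nN : val n != N by rewrite neq_ltn ltn_ord.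
  have [qp|qp] := gap_disj nN.
    by rewrite !clamp_le//; [lra|lra].
  by rewrite !clamp_ge//; [lra|lra].
lra.
Qed.

(** Since [K] dominates the increments of [G], both [K + G] and [K - G] are nondecreasing; the
    previous lemma applied to each gives the two halves of the absolute value. *)
Lemma sum_increments_norm_le (G K : R -> R) N :
  (forall x y, x <= y -> `|G y - G x| <= K y - K x) ->
  `|G b - G a - \sum_(n < N) (G (q n) - G (p n))| <=
    K b - K a - \sum_(n < N) (K (q n) - K (p n)).
Proof.
move=> GK.
have addH : {homo K \+ G : x y / x <= y}.
  by move=> x y /GK /=; rewrite ler_norml => /andP[]; lra.
have subH : {homo K \- G : x y / x <= y}.
  by move=> x y /GK /=; rewrite ler_norml => /andP[]; lra.
have := sum_increments_le N addH.
have := sum_increments_le N subH.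
have -> : \sum_(n < N) ((K \- G) (q n) - (K \- G) (p n)) =
    \sum_(n < N) (K (q n) - K (p n)) - \sum_(n < N) (G (q n) - G (p n)).
  by rewrite -sumrB; apply: eq_bigr => n _ /=; ring.
have -> : \sum_(n < N) ((K \+ G) (q n) - (K \+ G) (p n)) =
    \sum_(n < N) (K (q n) - K (p n)) + \sum_(n < N) (G (q n) - G (p n)).
  by rewrite -big_split; apply: eq_bigr => n _ /=; ring.
by move=> /= ? ?; rewrite ler_norml; apply/andP; split; lra.
Qed.

(** Each term is the length of the part of the gap lying to the left of x. *)
Definition gap_part N x := \sum_(n < N) (clamp (p n) (q n) x - p n).

Lemma gap_part_homo N : {homo gap_part N : x y / x <= y}.
Proof. by move=> x y xy; apply: ler_sum => n _; rewrite lerD2r clamp_homo. Qed.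

Lemma gap_part_lip N x y : x <= y -> gap_part N y <= gap_part N x + (y - x).
Proof.
move=> xy; rewrite -lerBlDl -sumrB.
under eq_bigr => n _.
  rewrite (_ : _ - _ = clamp x y (q n) - clamp x y (p n)).
    over.
  rewrite -clampB_sym//; first by lra.
  by have := gap_itv n; lra.
apply: (le_trans (sum_increments_le _ (@clamp_homo _ x y))).
have := clamp_itv a xy; have := clamp_itv b xy; lra.
Qed.

Lemma gap_part_b N : gap_part N b = \sum_(n < N) (q n - p n).
Proof.
by apply: eq_bigr => n _; rewrite clamp_ge//; have := gap_itv n; lra.
Qed.

Lemma gap_part_a N : gap_part N a = 0.
Proof.
apply: big1 => n _; rewrite clamp_le ?subrr//; have := gap_itv n; lra.
Qed.

Lemma gap_part_ge0 N x : 0 <= gap_part N x.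
Proof.
apply: sumr_ge0 => n _; rewrite subr_ge0.
have [_ [pq _]] := gap_itv n.
by have /andP[] := clamp_itv x pq.
Qed.

Lemma gap_part_le N x : gap_part N x <= b - a.
Proof.
apply: (@le_trans _ _ (\sum_(n < N) (q n - p n))).
  apply: ler_sum => n _; rewrite lerD2r.
  have [_ [pq _]] := gap_itv n.
  by have /andP[] := clamp_itv x pq.
by have /= := @sum_increments_le id N (fun x y => id).
Qed.

Lemma gap_part_nd x : nondecreasing_seq (gap_part ^~ x).
Proof.
apply/nondecreasing_seqP => N; rewrite /gap_part big_ord_recr/= lerDl subr_ge0.
have [_ [pq _]] := gap_itv N.
by have /andP[] := clamp_itv x pq.
Qed.

Definition gap_length x : R := limn (gap_part ^~ x).

Lemma gap_part_cvg x : gap_part ^~ x @ \oo --> gap_length x.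
Proof.
apply: nondecreasing_is_cvgn; first exact: gap_part_nd.
by exists (b - a) => _ [N _ <-]; exact: gap_part_le.
Qed.

Lemma gap_length_homo : {homo gap_length : x y / x <= y}.
Proof.
move=> x y xy; apply: ler_cvg_to (@gap_part_cvg x) (@gap_part_cvg y) _.
by near=> N; exact: gap_part_homo.
Unshelve. all: by end_near. Qed.

Lemma gap_length_lip x y : x <= y -> gap_length y <= gap_length x + (y - x).
Proof.
move=> xy; apply: ler_cvg_to (@gap_part_cvg y) _ _.
  by apply: cvgD; [exact: gap_part_cvg|exact: cvg_cst].
by near=> N; exact: gap_part_lip.
Unshelve. all: by end_near. Qed.

Lemma gap_length_itv x : 0 <= gap_length x <= b - a.
Proof.
apply/andP; split.
  apply: cvgr_to_ge (@gap_part_cvg x) _.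
  by near=> N; exact: gap_part_ge0.
apply: cvgr_to_le (@gap_part_cvg x) _.
by near=> N; exact: gap_part_le.
Unshelve. all: by end_near. Qed.

Lemma gap_length_a : gap_length a = 0.
Proof.
apply: cvg_unique (@gap_part_cvg a) _ => //.
rewrite (_ : gap_part ^~ a = cst 0); first exact: cvg_cst.
by apply/funext => N; exact: gap_part_a.
Qed.

(** The Lipschitz bound gives one inequality. For the other, once N > n the n-th term alone grows by
    [q n - p n], and the other terms do not decrease. *)
Lemma gap_length_gap n : gap_length (q n) - gap_length (p n) = q n - p n.
Proof.
have [_ [pq _]] := gap_itv n.
apply/eqP; rewrite eq_le lerBlDl gap_length_lip//= lerBrDl.
apply: ler_cvg_to _ (@gap_part_cvg (q n)) _.
  by apply: cvgD; [exact: gap_part_cvg|exact: cvg_cst].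
near=> N.
have nN : (n < N)%N by near: N; exact: nbhs_infty_gt.
rewrite -lerBrDl -sumrB (bigD1 (Ordinal nN))//= clamp_ge// clamp_le//.
rewrite -[leLHS]addr0; apply: lerD; first by lra.
by apply: sumr_ge0 => i _; have := clamp_homo (p i) (q i) pq; lra.
Unshelve. all: by end_near. Qed.

End gaps.

(** * Construction of the dense disjoint gaps *)

(** Dependent choice with full memory: the state of the recursion is the list of all earlier
    choices, as each new gap must avoid all earlier ones. *)
Lemma history_choice (T : pointedType) (P : seq T -> T -> Prop) :
  (forall s, exists x, P s x) ->
  exists g : nat -> T, forall n, P (mkseq g n) (g n).
Proof.
move=> /choice[F FP].
pose s := fix s n := if n is m.+1 then rcons (s m) (F (s m)) else [::].
exists (fun n => F (s n)) => n.
suff -> : mkseq (fun n => F (s n)) n = s n by exact: FP.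
by elim: n => //= n IH; rewrite mkseqS IH.
Qed.

Lemma near_forall_seq (T : eqType) (U : Type) (F : set_system U) (s : seq T)
    (P : T -> U -> Prop) : Filter F ->
  (forall t, t \in s -> \forall u \near F, P t u) ->
  \forall u \near F, forall t, t \in s -> P t u.
Proof.
move=> FF; elim: s => [_|t s IH sP]; first exact: nearW.
have tP := sP t (mem_head t s).
have /IH {}sP t' : t' \in s -> \forall u \near F, P t' u.
  by move=> t's; apply: sP; rewrite inE t's orbT.
apply: filterS2 tP sP => u Ptu Psu t'.
by rewrite inE => /predU1P[->//|]; exact: Psu.
Qed.

Section dense_gaps.
Context {R : realType} (small : nat -> R -> R -> Prop).
Hypothesis small0 : forall n, small n 0 0.
Hypothesis small_near : forall n d, 0 < d < 1 ->
  \forall r \near 0^'+, small n (d - r) (d + r).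

Let separated (g h : R * R) := g.2 <= h.1 \/ h.2 <= g.1.

(** Stage n treats the rational d with code n, or 0 if there is none, and makes sure that some gap
    contains it. The pair (0, 0) is a degenerate gap for stages with nothing to do; the premise on
    [h.1] makes it separated from every earlier gap. *)
Let step_prop (s : seq (R * R)) (g : R * R) :=
  (forall h, h \in s -> 0 <= h.1) ->
  let d : R := ratr (odflt 0 (unpickle (size s))) in
  [/\ 0 <= g.1 /\ g.1 <= g.2 /\ g.2 <= 1, g.2 = 0 \/ g.1 < g.2,
    small (size s) g.1 g.2, forall h, h \in s -> separated g h &
    0 < d < 1 -> exists h, h \in g :: s /\ h.1 <= d <= h.2].

(** If d is outside ]0, 1[ or already in a gap, take (0, 0). Otherwise d is at positive distance
    from the finitely many earlier closed gaps, and ]d - r, d + r[ works for every small r > 0. *)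
Let step_exists s : exists g, step_prop s g.
Proof.
have [s0|] := pselect (forall h, h \in s -> 0 <= h.1); last by exists (0, 0).
set d : R := ratr (odflt 0 (unpickle (size s))).
have [/andP[d0 d1]|nd] := pselect (0 < d < 1); last first.
  by exists (0, 0) => _; split => //=; [left|move=> h hs; left; exact: s0].
have [[h [hs dh]]|nh] := pselect (exists h, h \in s /\ h.1 <= d <= h.2).
  exists (0, 0) => _; split => //= [|h' hs'|_]; [by left|by left; exact: s0|].
  by exists h; rewrite inE hs orbT.
have near_sep : \forall r \near 0^'+,
    forall h, h \in s -> separated (d - r, d + r) h.
  apply: near_forall_seq => h hs.
  have [dh|hd] := ltP d h.1.
    near=> r; left; rewrite -lerBrDl; near: r.
    by apply: nbhs_right_le; rewrite subr_gt0.
  have [dh|dh] := ltP h.2 d.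
    near=> r; right; rewrite lerBrDr -lerBrDl; near: r.
    by apply: nbhs_right_le; rewrite subr_gt0.
  by exfalso; apply: nh; exists h; rewrite hd dh.
near (0 : R)^'+ => r.
have r0 : 0 < r by near: r; exact: nbhs_right_gt.
have rd : r < d by near: r; exact: nbhs_right_lt.
have rd1 : r < 1 - d by near: r; apply: nbhs_right_lt; rewrite subr_gt0.
exists (d - r, d + r) => _; split => /=.
- by lra.
- by right; lra.
- by near: r; apply: small_near; rewrite d0.
- by near: r.
- by exists (d - r, d + r); rewrite inE eqxx/=; split => //; lra.
Unshelve. all: by end_near. Qed.

Lemma dense_gaps : exists p q : nat -> R,
  [/\ forall n, 0 <= p n /\ p n <= q n /\ q n <= 1,
      forall n, small n (p n) (q n),
      forall i j, i != j -> q i <= p j \/ q j <= p i &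
      forall x y, 0 <= x -> x < y -> y <= 1 ->
        exists n d, [/\ p n < q n, p n <= d, d <= q n, x < d & d < y]].
Proof.
have [g gP] := history_choice step_exists.
(* Strong induction, because what [step_prop] says of stage n is conditional on the earlier left
   endpoints being nonnegative. *)
have g0 n : 0 <= (g n).1.
  elim/ltn_ind: n => n IH; have [|//] := gP n; last by move=> [].
  by move=> h /mapP[i]; rewrite mem_iota => /andP[_ ni] ->; exact: IH.
have gs n h : h \in mkseq g n -> 0 <= h.1.
  by move=> /mapP[i _ ->].
exists (fun n => (g n).1), (fun n => (g n).2); split.
- by move=> n; have [] := gP n (gs n).
- by move=> n; have [_ _] := gP n (gs n); rewrite size_mkseq.
- have sep i j : (i < j)%N -> (g j).2 <= (g i).1 \/ (g i).2 <= (g j).1.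
    move=> ij; have [_ _ _ + _] := gP j (gs j); apply.
    by apply/mapP; exists i => //; rewrite mem_iota.
  by move=> i j; rewrite neq_ltn => /orP[/sep|/sep] []; auto.
(* A rational c strictly between x and y was treated at stage [pickle c]. As c > 0, the gap
   containing it is not the degenerate one. *)
- move=> x y x0 xy y1; have [c /=] := rat_in_itvoo xy.
  rewrite in_itv/= => /andP[xc cy].
  have [_ _ _ _] := gP (pickle c) (gs _).
  rewrite size_mkseq pickleK/= (le_lt_trans x0 xc) (lt_le_trans cy y1).
  move=> /(_ isT)[h []].
  have -> : (h \in g (pickle c) :: mkseq g (pickle c)) =
            (h \in mkseq g (pickle c).+1).
    by rewrite mkseqS mem_rcons.
  move=> /mapP[n _ ->] /andP[pc cq]; exists n, (ratr c); split => //.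
  by have [_ [q0|//] _ _ _] := gP n (gs n); lra.
Qed.

End dense_gaps.

(** * Norm estimates and completeness of the free space *)

Section free_space_theory.
Context {R : realType} {M : metricType R} {m0 : M}.
Implicit Types (u v : free_space m0) (h : Lip0 m0).

Lemma free_valB u v h : free_val (u - v) h = free_val u h - free_val v h.
Proof. by []. Qed.

Lemma free_val_sum N (w : 'I_N -> free_space m0) h :
  free_val (\sum_(i < N) w i) h = \sum_(i < N) free_val (w i) h.
Proof. by apply: (big_morph (fun v => free_val v h)). Qed.

Lemma free_val_le u h : `|free_val u h| <= `|u| * `|h|.
Proof. exact: dual_normP. Qed.

Lemma free_norm_le u (k : R) : 0 <= k ->
  (forall h, `|free_val u h| <= k * `|h|) -> `|u| <= k.
Proof. exact: best_constant_le. Qed.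

Lemma deltaB_le x y : `|delta m0 x - delta m0 y| <= mdist y x.
Proof.
by apply: free_norm_le => [|h]; rewrite ?mdist_ge0// mulrC; exact: lip0_normP.
Qed.

(** The values on each Lipschitz function converge in R, and the pointwise limit is a bounded
    functional that inherits the rate [e]. It stays in the free space because that space is closed
    in the dual. *)
Lemma free_space_cauchy_cvg (u : nat -> free_space m0) (e : nat -> R) :
  (forall n N, `|u (n + N)%N - u N| <= e N) -> e @ \oo --> 0 ->
  exists v, forall N, `|v - u N| <= e N.
Proof.
move=> ue e0.
have eN_ge0 N : 0 <= e N by apply: le_trans (ue 0 N).
have ueh n N h : `|free_val (u (n + N)%N) h - free_val (u N) h| <= e N * `|h|.
  by rewrite -free_valB (le_trans (free_val_le _ _))// ler_wpM2r.
have eh0 h : (fun N => e N * `|h|) @ \oo --> 0.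
  by rewrite -(mul0r `|h|); apply: cvgM => //; exact: cvg_cst.
have uh_cvg h : cvgn (fun N => free_val (u N) h : R).
  apply/cauchy_cvgP/cauchy_exP => eps eps0.
  have /cvgrPdist_lt/(_ _ eps0)[N _ /(_ N (leqnn N))] := eh0 h.
  rewrite /= sub0r normrN ger0_norm ?mulr_ge0// => eN.
  exists (free_val (u N) h); exists N => // n /= Nn.
  rewrite /ball/= distrC -(subnK Nn); exact: le_lt_trans (ueh _ _ _) eN.
pose phi h : R^o := limn (fun N => free_val (u N) h : R).
have phi_le h N : `|phi h - free_val (u N) h| <= e N * `|h|.
  have : (fun n => `|free_val (u n) h - free_val (u N) h| : R) @ \oo -->
         `|phi h - free_val (u N) h|.
    by apply: cvg_norm; apply: cvgB; [exact: uh_cvg|exact: cvg_cst].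
  move=> /cvgr_to_le; apply; exists N => // n /= Nn.
  by rewrite -(subnK Nn).
have phiP : phi \in @dual_pred R (Lip0 m0).
  apply/dual_predP; split=> [a g h|].
    apply: cvg_lim => //.
    rewrite (_ : (fun N => _) =
                 fun N => a * free_val (u N) g + free_val (u N) h).
      apply: cvgD; last exact: uh_cvg.
      by apply: cvgM; [exact: cvg_cst|exact: uh_cvg].
    by apply/funext => N; rewrite dual_linear.
  exists (e 0 + `|u 0|) => h; rewrite mulrDl.
  rewrite -[phi h](subrK (free_val (u 0) h)) (le_trans (ler_normD _ _))//.
  by rewrite lerD// free_val_le.
pose Phi : dual (Lip0 m0) := MkDual phiP.
have Phi_le N : `|Phi - free_val (u N)| <= e N.
  by apply: best_constant_le => // h; exact: phi_le.
have PhiP : Phi \in free_pred m0.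
  apply/free_predP/closure_normP => eps eps0.
  have eps2 : 0 < eps / 2 by rewrite divr_gt0.
  have /cvgrPdist_lt/(_ _ eps2)[N _ /(_ N (leqnn N))] := e0.
  rewrite /= sub0r normrN ger0_norm// => eN.
  have /free_predP/closure_normP/(_ _ eps2)[w Sw uw] := free_mem (u N).
  exists w => //; rewrite -(subrK (free_val (u N)) Phi) -addrA.
  rewrite (le_lt_trans (ler_normD _ _))// [ltRHS]splitr ltrD//.
  exact: le_lt_trans eN.
by exists (MkFree PhiP).
Qed.

End free_space_theory.

(** * The unit interval and continuity in terms of distances *)

Section unit_interval.
Context {R : realType}.

Lemma to_unit_proof (x : R) : (clamp 0 1 x : R^o) \in unit_interval R.
Proof. by rewrite inE /=; exact: clamp_itv. Qed.

(** Clamping makes the map total, so real numbers can be used as points without carrying a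
    membership proof; it is faithful only on [0, 1]. *)
Definition to_unit (x : R) : unit_interval R := SigSub (to_unit_proof x).

Lemma to_unitK (x : R) : 0 <= x <= 1 -> \val (to_unit x) = x.
Proof. exact: clamp_id. Qed.

Lemma unit_itv (x : unit_interval R) : 0 <= (\val x : R) <= 1.
Proof. by case: x => x /=; rewrite inE. Qed.

Lemma mdist_unitE (x y : unit_interval R) : mdist x y = `|\val y - \val x : R|.
Proof. by []. Qed.

End unit_interval.

Section metric_continuity.
Context {R : realType} {M N : metricType R}.

Lemma lipschitz_continuous (k : R) (f : M -> N) :
  lipschitz_map k f -> continuous f.
Proof.
move=> fk x; apply/metricType_numDomainType.cvgrPdist_lt => e e0.
apply/metricType_numDomainType.nbhs_mdistP.
have k1 : 0 < `|k| + 1 by rewrite ltr_wpDl.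
exists (e / (`|k| + 1)) => [|y /=]; first exact: divr_gt0.
rewrite ltr_pdivlMr// mulrC; apply: le_lt_trans; rewrite (le_trans (fk _ _))//.
by rewrite ler_wpM2r ?mdist_ge0// ler_wpDr// ler_norm.
Qed.

Lemma continuous_mdist (f : M -> N) : continuous f ->
  forall (x : M) (e : R), 0 < e -> exists2 d : R, 0 < d &
    forall y, mdist x y < d -> mdist (f x) (f y) < e.
Proof.
move=> fc x e e0.
have /metricType_numDomainType.cvgrPdist_lt/(_ _ e0) := fc x.
by move=> /metricType_numDomainType.nbhs_mdistP[d /= d0 dP]; exists d.
Qed.

End metric_continuity.

(** * The complement of the gaps: total disconnectedness and completeness *)

Section cantor_set.
Context {R : realType} {L : R} (rho : metric R (unit_interval R)).
Hypothesis L_gt0 : 0 < L.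
Hypothesis id_lipschitz :
  lipschitz_map L (fun x : metric_space rho => x : unit_interval R).
Hypothesis id_inv_continuous :
  continuous (fun x : unit_interval R => x : metric_space rho).

Definition coord (x : metric_space rho) : R := \val (x : unit_interval R).

Lemma coord_lip x y : `|coord y - coord x| <= L * mdist x y.
Proof. exact: id_lipschitz. Qed.

Lemma coord_continuous : continuous coord.
Proof. exact: (@lipschitz_continuous _ (metric_space rho) R^o L). Qed.

Lemma metric_ball_coord (x : metric_space rho) (e : R) : 0 < e ->
  exists2 d : R, 0 < d &
    forall y : metric_space rho, `|coord x - coord y| < d -> mdist x y < e.
Proof.
move=> e0; have [d d0 dP] := continuous_mdist id_inv_continuous x e0.
by exists d => // y; rewrite distrC; exact: dP.
Qed.

(** Continuity of the identity at d puts both endpoints within e / 2 of d for [rho]; the triangle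
    inequality through d concludes. *)
Lemma small_gap_near (e : R) (d : R) : 0 < e -> 0 < d < 1 ->
  \forall r \near 0^'+, rho (to_unit (d - r)) (to_unit (d + r)) <= e.
Proof.
move=> e0 /andP[d0 d1].
have e2 : 0 < e / 2 by rewrite divr_gt0.
have [k k0 kP] := metric_ball_coord (to_unit d) e2.
near=> r.
have r0 : 0 < r by near: r; exact: nbhs_right_gt.
have rd : r < d by near: r; exact: nbhs_right_lt.
have rk : r < k by near: r; exact: nbhs_right_lt.
have rd1 : r < 1 - d by near: r; apply: nbhs_right_lt; rewrite subr_gt0.
have dist_lt s : `|s| = r -> rho (to_unit d) (to_unit (d + s)) <= e / 2.
  move=> sr; have := ler_norm s; have := ler_norm (- s); rewrite normrN sr.
  move=> rs sr'; apply/ltW/kP; rewrite /coord to_unitK ?d0 ?ltW//.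
  rewrite to_unitK; first by rewrite opprD addrA subrr add0r normrN sr.
  by apply/andP; split; lra.
have := dist_lt r; have := dist_lt (- r).
rewrite normrN gtr0_norm// => /(_ erefl) h1 /(_ erefl) h2.
rewrite (le_trans (metric_dist_triangle _ (to_unit d) _ _))//.
by rewrite metric_dist_sym [leRHS]splitr lerD.
Unshelve. all: by end_near. Qed.

Context {p q : nat -> R}.
Hypothesis gap_itv : forall n, 0 <= p n /\ p n <= q n /\ q n <= 1.
Hypothesis gap_disj : forall i j, i != j -> q i <= p j \/ q j <= p i.
Hypothesis gap_dense : forall x y, 0 <= x -> x < y -> y <= 1 ->
  exists n d, [/\ p n < q n, p n <= d, d <= q n, x < d & d < y].

(** Only open gaps are removed, so their endpoints remain available as points of the set. *)
Definition gap_complement : set (metric_space rho) :=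
  [set x | forall n, ~ (p n < coord x < q n)].
Local Notation A := gap_complement.

(** By density some gap has a point strictly between x and y; as neither x nor y is inside this gap,
    all of it lies between them. *)
Lemma gap_between x y : A x -> A y -> coord x < coord y ->
  exists n, [/\ p n < q n, coord x <= p n & q n <= coord y].
Proof.
move=> Ax Ay xy; have /andP[x0 _] := unit_itv x; have /andP[_ y1] := unit_itv y.
have [n [d [pq pd dq xd dy]]] := gap_dense x0 xy y1.
exists n; split => //.
  rewrite leNgt; apply/negP => px; apply: (Ax n).
  by rewrite px (lt_le_trans xd).
by rewrite leNgt; apply/negP => yq; apply: (Ay n); rewrite yq (le_lt_trans pd).
Qed.

Lemma coord_inj : injective coord.
Proof. by move=> x y; exact: val_inj. Qed.

(** The coordinate sends a connected subset to an interval. If it took two values, the midpoint of a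
    gap between them would be the coordinate of a point of [A]. *)
Lemma totally_disconnected_gap_complement : totally_disconnected A.
Proof.
move=> x Ax; apply/seteqP; split=> [y [C [Cx CA Cconn] Cy]|_ ->]; last first.
  exact: connected_component_refl.
suff no_lt u v : C u -> C v -> ~ coord u < coord v.
  apply: coord_inj; apply/eqP; rewrite eq_le !leNgt.
  by apply/andP; split; apply/negP; exact: no_lt.
move=> Cu Cv uv; have [n [pq up qv]] := gap_between (CA _ Cu) (CA _ Cv) uv.
have : is_interval (coord @` C).
  apply/connected_intervalP; apply: connected_continuous_connected => //.
  exact/continuous_subspaceT/coord_continuous.
move=> /(_ (coord u) (coord v)) /(_ (imageP _ Cu) (imageP _ Cv)).
move=> /(_ ((p n + q n) / 2)) [|z Cz zE]; first by lra.
by apply: (CA _ Cz n); rewrite zE; lra.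
Qed.

(** The Lipschitz coordinate carries a Cauchy filter to a Cauchy filter of reals, with a limit c.
    Continuity of the inverse identity brings the convergence to c back to [rho]. *)
Lemma complete_gap_complement : complete_space A.
Proof.
move=> F FF /cauchyP Fc.
pose G : set_system R := (coord \o set_val) @ F.
have GF : ProperFilter G by exact: fmap_proper_filter.
have : cauchy G.
  apply/cauchyP => e e0.
  have [a Fa] := Fc _ (divr_gt0 e0 L_gt0).
  exists (coord (set_val a)).
  change (F [set b | ball (coord (set_val a)) e (coord (set_val b))]).
  apply: filterS Fa => b ab.
  have : ball (set_val a) (e / L) (set_val b) by [].
  rewrite ballEmdist /= ltr_pdivlMr// mulrC => {}ab.
  by rewrite /ball/= distrC; apply: le_lt_trans ab; exact: coord_lip.
move=> /cauchy_cvg Gc.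
pose c : R := lim G.
have GE e : 0 < e -> \forall a \near F, `|c - coord (set_val a)| < e.
  by move: e; apply/cvgrPdist_lt.
have c01 : 0 <= c <= 1.
  apply/andP; split.
    apply: cvgr_to_ge Gc _; apply: nearW => a.
    by have /andP[] := unit_itv (set_val a).
  apply: cvgr_to_le Gc _; apply: nearW => a.
  by have /andP[] := unit_itv (set_val a).
have cE : coord (to_unit c) = c by exact: to_unitK.
have Ac : A (to_unit c).
  move=> n; rewrite cE => /andP[pc cq].
  (* If c were inside a gap, points of [A] with coordinates this close to c would be inside it
     too. *)
  have e0 : 0 < Num.min (c - p n) (q n - c) by rewrite lt_min !subr_gt0 pc.
  have [a] := filter_ex (GE _ e0).
  rewrite lt_min => /andP[ap aq]; apply: (set_valP a n).
  have := ler_norm (c - coord (set_val a)).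
  have := ler_norm (coord (set_val a) - c); rewrite distrC.
  by move=> ? ?; apply/andP; split; lra.
exists (SigSub (mem_set Ac)).
apply/metricType_numDomainType.fcvgrPdist_lt => e e0.
have [d d0 dP] := metric_ball_coord (to_unit c) e0.
by apply: filterS (GE _ d0) => a ca; apply: dP; rewrite cE.
Qed.

Lemma gap_complement_to_unit t : 0 <= t <= 1 -> (forall n, ~ (p n < t < q n)) ->
  A (to_unit t).
Proof. by move=> t01 At n; rewrite /coord to_unitK. Qed.

Lemma gap_complement0 : A (to_unit 0).
Proof.
apply: gap_complement_to_unit => [|n]; first by rewrite lexx ler01.
by have := gap_itv n; lra.
Qed.

Lemma gap_complement1 : A (to_unit 1).
Proof.
apply: gap_complement_to_unit => [|n]; first by rewrite lexx ler01.
by have := gap_itv n; lra.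
Qed.

Lemma gap_complement_left n : A (to_unit (p n)).
Proof.
apply: gap_complement_to_unit => [|m]; have := gap_itv n; first by lra.
have := gap_itv m; have [->|nm] := eqVneq m n; first by lra.
by have := gap_disj nm; lra.
Qed.

Lemma gap_complement_right n : A (to_unit (q n)).
Proof.
apply: gap_complement_to_unit => [|m]; have := gap_itv n; first by lra.
have := gap_itv m; have [->|nm] := eqVneq m n; first by lra.
by have := gap_disj nm; lra.
Qed.

(** * The injective Lipschitz map *)

Let zeroA : A := SigSub (mem_set gap_complement0).
Let oneA : A := SigSub (mem_set gap_complement1).
Let left n : A := SigSub (mem_set (@gap_complement_left n)).
Let right n : A := SigSub (mem_set (@gap_complement_right n)).

Definition coordA (a : A) : R := coord (set_val a).

Let coordA_to_unit t (At : A (to_unit t)) : 0 <= t <= 1 ->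
  coordA (SigSub (mem_set At)) = t.
Proof. exact: to_unitK. Qed.

Let coordA_left n : coordA (left n) = p n.
Proof. by apply: coordA_to_unit; have := gap_itv n; lra. Qed.

Let coordA_right n : coordA (right n) = q n.
Proof. by apply: coordA_to_unit; have := gap_itv n; lra. Qed.

Let coordA_zero : coordA zeroA = 0.
Proof. by apply: coordA_to_unit; lra. Qed.

Let coordA_one : coordA oneA = 1.
Proof. by apply: coordA_to_unit; lra. Qed.

Let F := gap_length p q.

Let F01 t : 0 <= F t <= 1.
Proof. by have := gap_length_itv gap_itv gap_disj t; rewrite subr0. Qed.

Lemma gap_length_dist x y : `|F y - F x| <= `|y - x|.
Proof.
wlog xy : x y / x <= y => [hw|].
  by have [/hw//|/ltW/hw] := leP x y; rewrite distrC [leRHS]distrC.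
rewrite !ger0_norm ?subr_ge0//; last exact: (gap_length_homo gap_itv gap_disj).
by rewrite lerBlDl; exact: (gap_length_lip gap_itv gap_disj).
Qed.

Definition cantor_map (a : A) : unit_interval R := to_unit (F (coordA a)).

Lemma cantor_map_lip : lipschitz_map L cantor_map.
Proof.
move=> a b; rewrite mdist_unitE !to_unitK//.
exact: le_trans (gap_length_dist _ _) (coord_lip _ _).
Qed.

Lemma cantor_map_inj : injective cantor_map.
Proof.
have no_lt a b : cantor_map a = cantor_map b -> ~ coordA a < coordA b.
  move=> fab ab; have Fab : F (coordA a) = F (coordA b).
    rewrite -(to_unitK (F01 (coordA a))) -(to_unitK (F01 (coordA b))).
    by rewrite -/(cantor_map a) fab.
  (* [F] is nondecreasing and gains [q n - p n > 0] across this gap. *)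
  have [n [pq ap qb]] := gap_between (set_valP a) (set_valP b) ab.
  have := gap_length_gap gap_itv gap_disj n.
  have := gap_length_homo gap_itv gap_disj ap.
  have := gap_length_homo gap_itv gap_disj qb.
  by rewrite -/F -/(coordA a) -/(coordA b); lra.
move=> a b fab; apply/val_inj/coord_inj/eqP; rewrite eq_le !leNgt.
by apply/andP; split; apply/negP; exact: no_lt.
Qed.

Lemma cantor_map_zero : cantor_map zeroA = to_unit 0.
Proof. by rewrite /cantor_map coordA_zero /F (gap_length_a gap_itv). Qed.

Let f : lip0_map zeroA (to_unit (0 : R)) :=
  MkLip0Map cantor_map_zero (ex_intro _ L cantor_map_lip).

Let coordA_lip0P : (coordA : A -> R^o) \in lip0_pred zeroA.
Proof. by apply/lip0_predP; split => //; exists L => x y; exact: coord_lip. Qed.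

(** The test function that detects that the limit of [gamma] is nonzero. *)
Let coord_lip0 : Lip0 zeroA := MkLip0 coordA_lip0P.

(** * The nonzero element killed by the linearization *)

Hypothesis gap_small : forall n,
  q n - p n <= 2^-1 ^+ n.+2 /\
  rho (to_unit (p n)) (to_unit (q n)) <= 2^-1 ^+ n.+1.

Let gamma N := delta zeroA oneA - delta zeroA zeroA -
  \sum_(i < N) (delta zeroA (right i) - delta zeroA (left i)).

Let gamma_cauchy n N : `|gamma (n + N)%N - gamma N| <= 2^-1 ^+ N.
Proof.
(* Induction on n needs the exact geometric sum from N to n + N, not just its bound. *)
suff : `|gamma (n + N)%N - gamma N| <= 2^-1 ^+ N - 2^-1 ^+ (n + N).
  by move=> h; apply: le_trans h _; rewrite gerBl exprn_ge0.
elim: n => [|n IH]; first by rewrite !subrr normr0.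
rewrite addSn /gamma big_ord_recr/= -/(gamma N) opprD addrA -/(gamma (n + N)).
rewrite addrAC (le_trans (ler_normB _ _))//.
have : `|delta zeroA (right (n + N)) - delta zeroA (left (n + N))| <=
    2^-1 ^+ (n + N).+1.
  by apply: le_trans (deltaB_le _ _) _; exact: (gap_small (n + N)).2.
move: IH; rewrite exprS; set a := `|_|; set b := `|_|; lra.
Qed.

Let gamma_val g N : free_val (gamma N) g = g oneA - g zeroA -
  \sum_(i < N) (g (right i) - g (left i)).
Proof. by rewrite !free_valB free_val_sum. Qed.

(** Any bound below 1 would do: it keeps the value of [gamma N] at the coordinate function away from
    0. *)
Let sum_gap_le N : \sum_(i < N) (q i - p i) <= 2^-1.
Proof.
suff : \sum_(i < N) (q i - p i) <= 2^-1 - 2^-1 ^+ N.+1.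
  by move=> h; apply: le_trans h _; rewrite gerBl exprn_ge0.
elim: N => [|N IH]; first by rewrite big_ord0 expr1 subrr.
rewrite big_ord_recr/=; have := (gap_small N).1.
by move: IH; rewrite !exprS; lra.
Qed.

Let half_cvg0 (c : R) : (fun N : nat => c * 2^-1 ^+ N) @ \oo --> 0.
Proof.
rewrite -(mulr0 c); apply: cvgM; first exact: cvg_cst.
by apply: cvg_expr; rewrite ger0_norm//; lra.
Qed.

(** For a test function g, the increments of g composed with [F] are dominated by those of
    [|g| * F], so [sum_increments_norm_le] bounds the value at g. As [F 1] is the total gap length,
    the right-hand side tends to 0. *)
Lemma linearization_gamma_le N :
  `|linearization f (gamma N)| <= F 1 - \sum_(i < N) (q i - p i).
Proof.
have [[Tlin _] Tdelta] := linearizationP f.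
pose T : {linear free_space zeroA -> free_space (to_unit 0)} :=
  HB.pack (linearization f) (GRing.isLinear.Build R _ _ _ _ Tlin).
have Tgamma : linearization f (gamma N) =
    delta (to_unit 0) (cantor_map oneA) - delta (to_unit 0) (cantor_map zeroA) -
    \sum_(i < N) (delta (to_unit 0) (cantor_map (right i)) -
                  delta (to_unit 0) (cantor_map (left i))).
  rewrite -[linearization f]/(T : _ -> _) !linearB linear_sum /= !Tdelta.
  congr (_ - _); apply: eq_bigr => i _.
  by rewrite -[linearization f]/(T : _ -> _) linearB /= !Tdelta.
(* The bound is rewritten as the part of the increment of [F] not accounted for by the first N
   gaps. *)
have FE : F 1 - \sum_(i < N) (q i - p i) =
    F 1 - F 0 - \sum_(i < N) (F (q i) - F (p i)).
  have -> : F 0 = 0 by exact: gap_length_a.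
  rewrite subr0; congr (_ - _).
  by apply: eq_bigr => i _; rewrite (gap_length_gap gap_itv gap_disj).
rewrite FE; apply: free_norm_le => [|g].
  rewrite subr_ge0; apply: (sum_increments_le gap_itv gap_disj).
  exact: (gap_length_homo gap_itv gap_disj).
rewrite Tgamma !free_valB free_val_sum.
pose G t : R := g (to_unit (F t)); pose K t := `|g| * F t.
have GK x y : x <= y -> `|G y - G x| <= K y - K x.
  move=> xy; rewrite -mulrBr (le_trans (lip0_normP g _ _))// ler_wpM2l//.
  rewrite mdist_unitE !to_unitK// ger0_norm// subr_ge0.
  exact: (gap_length_homo gap_itv gap_disj).
have := sum_increments_norm_le gap_itv gap_disj N GK.
rewrite /K -mulrBr.
under [X in _ <= _ - X]eq_bigr do rewrite -mulrBr.
rewrite -mulr_sumr -mulrBr mulrC; apply: le_trans.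
rewrite le_eqVlt; apply/orP; left; apply/eqP; congr `| _ |.
have Gcoord a t : coordA a = t -> g (cantor_map a) = G t by move=> <-.
congr (_ - _); first by congr (_ - _); exact: Gcoord.
apply: eq_bigr => i _; rewrite free_valB.
by rewrite -(Gcoord _ _ (coordA_right i)) -(Gcoord _ _ (coordA_left i)).
Qed.

Lemma linearization_not_injective : ~ injective (linearization f).
Proof.
have half_cvg : (fun N : nat => 2^-1 ^+ N : R) @ \oo --> 0.
  by apply: cvg_expr; rewrite ger0_norm//; lra.
have [v vP] := free_space_cauchy_cvg gamma_cauchy half_cvg.
(* If v were 0, [gamma N] would take a value of size at most [|coord_lip0| * 2^-N] at the coordinate
   function, whereas this value is 1 minus a sum of gap lengths, hence at least 1/2. *)
have v_neq0 : v != 0.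
  apply/eqP => v0; suff : (2^-1 : R) <= 0 by lra.
  apply: cvgr_to_ge (half_cvg0 `|coord_lip0|) _; apply: nearW => N.
  rewrite mulrC (@le_trans _ _ (`|v - gamma N| * `|coord_lip0|)) ?ler_wpM2r//.
  apply: le_trans (free_val_le _ _); rewrite v0 sub0r.
  rewrite -[free_val _ _]/(- free_val (gamma N) coord_lip0) normrN.
  apply: le_trans (ler_norm _); rewrite gamma_val /= coordA_one coordA_zero.
  under eq_bigr do rewrite coordA_right coordA_left.
  by have := sum_gap_le N; lra.
move=> finj; have [[Tlin [k Tk]] _] := linearizationP f.
pose T : {linear free_space zeroA -> free_space (to_unit 0)} :=
  HB.pack (linearization f) (GRing.isLinear.Build R _ _ _ _ Tlin).
move/eqP: v_neq0; apply; apply: finj.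
rewrite -[linearization f]/(T : _ -> _) linear0.
apply/eqP; rewrite -normr_le0.
(* The image of v splits into that of [v - gamma N], bounded through the operator bound k, and that
   of [gamma N], bounded by the missing gap length. *)
have bound_cvg :
    (fun N => `|k| * 2^-1 ^+ N + (F 1 - gap_part p q N 1)) @ \oo --> 0.
  rewrite -[X in _ --> X]addr0 -[X in _ --> _ + X](subrr (F 1)).
  apply: cvgD; first exact: half_cvg0.
  by apply: cvgB; [exact: cvg_cst|exact: (gap_part_cvg gap_itv gap_disj)].
apply: cvgr_to_ge bound_cvg _; apply: nearW => N.
rewrite (gap_part_b gap_itv) -[v](subrK (gamma N)) linearD.
rewrite (le_trans (ler_normD _ _))// lerD//; last exact: linearization_gamma_le.
rewrite (le_trans (Tk _))// (@le_trans _ _ (`|k| * `|v - gamma N|))//.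
  by rewrite ler_wpM2r// ler_norm.
by rewrite ler_wpM2l.
Qed.

Lemma exists_noninjective_linearization :
  exists (B : set (metric_space rho)) (a0 : B) (b0 : unit_interval R)
         (h : lip0_map a0 b0),
    [/\ totally_disconnected B, complete_space B, injective h
      & ~ injective (linearization h)].
Proof.
exists A, zeroA, (to_unit 0), f; split.
- exact: totally_disconnected_gap_complement.
- exact: complete_gap_complement.
- exact: cantor_map_inj.
- exact: linearization_not_injective.
Qed.

End cantor_set.

Theorem proposition5p5 (R : realType) (L : R) (rho : metric R (unit_interval R))
  (L_gt0 : 0 < L)
  (id_lipschitz :
    lipschitz_map L (fun x : metric_space rho => x : unit_interval R))
  (id_inv_continuous :
    continuous (fun x : unit_interval R => x : metric_space rho)) :
  exists (A : set (metric_space rho)) (a0 : A) (b0 : unit_interval R)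
         (f : lip0_map a0 b0),
    [/\ totally_disconnected A, complete_space A, injective f
      & ~ injective (linearization f)].
Proof.
(* The first exponent makes the lengths sum to at most 1/2; the second makes the tail of the [rho]
   distances from N on at most [2^-N]. *)
pose small n (s t : R) := t - s <= 2^-1 ^+ n.+2 /\
  rho (to_unit s) (to_unit t) <= 2^-1 ^+ n.+1.
have small0 n : small n 0 0.
  by split; rewrite ?metric_distxx ?subrr exprn_ge0.
have small_near n d : 0 < d < 1 ->
    \forall r \near 0^'+, small n (d - r) (d + r).
  move=> d01; near=> r; split; last first.
    by near: r; apply: small_gap_near => //; rewrite exprn_gt0.
  (* The gap has length 2r, hence one more factor 1/2. *)
  have : r <= 2^-1 ^+ n.+3 by near: r; apply: nbhs_right_le; rewrite exprn_gt0.
  by rewrite [_ ^+ n.+3]exprS; lra.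
have [p [q [gap_itv gap_small gap_disj gap_dense]]] :=
  dense_gaps small0 small_near.
exact: (exists_noninjective_linearization L_gt0 id_lipschitz
  id_inv_continuous gap_itv gap_disj gap_dense gap_small).
Unshelve. all: by end_near. Qed.
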